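(* Every simplicial complex is homotopy equivalent to a fully exposed one. Explicitly, for a simplicial complex $\Delta$ on $[n]$, let $\mathrm{Wh}(\Delta)$ be the simplicial complex obtained from $\Delta$ by adjoining a new vertex $v_F$ for each facet $F\in\mathcal F(\Delta)$ (the $v_F$ being pairwise distinct) and replacing the facet $F$ by $F\cup\{v_F\}$. Then $\mathrm{Wh}(\Delta)$ is fully exposed and $\mathrm{Wh}(\Delta)\simeq\Delta$ (homotopy equivalence of geometric realizations).
   Context: For $n\ge 1$, $[n]=\{1,\dots,n\}$. A simplicial complex $\Delta$ on $[n]$ is a collection of subsets of $[n]$ (faces) closed under taking subsets; it is always assumed that $\{i\}\in\Delta$ for every $i\in[n]$. The same notions are used for complexes on any finite vertex set. Facets are the inclusion-maximal faces; $\mathcal F(\Delta)$ is the set of facets. $\mathrm{Wh}(\Delta)$ is the complex on $[n]\cup\{v_F:F\in\mathcal F(\Delta)\}$ whose faces are the subsets of the sets $F\cup\{v_F\}$, $F\in\mathcal F(\Delta)$. For a face $S$, $\operatorname{cl}(S)$ is the intersection of all facets containing $S$. For a vertex $i$, $\mathcal A_i(\Delta)$ is the set of faces $S$ with $i\notin S$ and $i\in\operatorname{cl}(S)$. A facet $F$ is exposed if there exist a vertex $i$ and $S\in\mathcal A_i(\Delta)$ with $S\subseteq F$. $\Delta$ is fully exposed if every facet is exposed. *)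

(* Defs.v *)
From HB Require Import structures.
From mathcomp Require Import all_boot all_order all_algebra.
From mathcomp Require Import all_classical all_reals all_analysis.
Set Implicit Arguments.
Unset Strict Implicit.
Unset Printing Implicit Defensive.
Import Order.TTheory GRing.Theory Num.Theory.
Import numFieldNormedType.Exports.

Section SimplicialComplex.
Local Open Scope set_scope.

(* The vertex set is the whole of T, every point of which must be a face;
   hence set0 is a face as soon as T is inhabited. *)
Record simplicial_complex (T : finType) := SimplicialComplex {
  faces :> {set {set T}};
  faces_sub : forall A B : {set T}, B \in faces -> A \subset B -> A \in faces;
  faces_vertex : forall i : T, [set i] \in faces }.

Definition facets (T : finType) (D : simplicial_complex T) : {set {set T}} :=
  [set F | maxset (fun A => A \in faces D) F].

Definition cl (T : finType) (D : simplicial_complex T) (S : {set T}) :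
    {set T} :=
  \bigcap_(F in facets D | S \subset F) F.

Definition exposing_faces (T : finType) (D : simplicial_complex T) (i : T) :
    {set {set T}} :=
  [set S in faces D | (i \notin S) && (i \in cl D S)].

Definition exposed (T : finType) (D : simplicial_complex T) (F : {set T}) :
    Prop :=
  exists i : T, exists2 S, S \in exposing_faces D i & S \subset F.

Definition fully_exposed (T : finType) (D : simplicial_complex T) : Prop :=
  forall F, F \in facets D -> exposed D F.

(* inl i is the old vertex i, inr F is the new vertex v_F. *)
Definition Wh_vertex (T : finType) (D : simplicial_complex T) : finType :=
  (T + {F : {set T} | F \in facets D})%type.

Definition Wh_facet (T : finType) (D : simplicial_complex T)
    (F : {F : {set T} | F \in facets D}) : {set Wh_vertex D} :=
  inr F |: [set inl i | i in val F].

Definition Wh_faces (T : finType) (D : simplicial_complex T) :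
    {set {set Wh_vertex D}} :=
  [set S : {set Wh_vertex D} | [exists F, S \subset Wh_facet F]].

Lemma Wh_faces_sub (T : finType) (D : simplicial_complex T)
    (A B : {set Wh_vertex D}) :
  B \in Wh_faces D -> A \subset B -> A \in Wh_faces D.
Proof.
rewrite !inE => /existsP[F BF] AB; apply/existsP; exists F.
exact: fintype.subset_trans AB BF.
Qed.

Lemma Wh_faces_vertex (T : finType) (D : simplicial_complex T)
    (v : Wh_vertex D) : [set v] \in Wh_faces D.
Proof.
rewrite inE; apply/existsP; case: v => [i|F]; last first.
  by exists F; rewrite finset.sub1set setU11.
have [F Fmax iF] := maxset_exists (faces_vertex D i).
have FD : F \in facets D by rewrite inE.
exists (exist _ F FD); rewrite finset.sub1set !inE /=; apply/imsetP; exists i => //.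
by rewrite -finset.sub1set.
Qed.

Definition Wh (T : finType) (D : simplicial_complex T) :
    simplicial_complex (Wh_vertex D) :=
  SimplicialComplex (@Wh_faces_sub T D) (@Wh_faces_vertex T D).

End SimplicialComplex.

Section Homotopy.
Local Open Scope classical_set_scope.
Local Open Scope ring_scope.

(* Points are given by their barycentric coordinates. As a type, the
   realization carries the topology induced by the product topology of R^T. *)
Definition geometric_realization (R : realType) (T : finType)
    (D : simplicial_complex T) : set (prod_topology (fun _ : T => R)) :=
  [set x | [/\ forall i, 0 <= x i, \sum_i x i = 1 &
               [set i | x i != 0]%SET \in faces D]].

(* Only the values of H on X * [0, 1] matter. *)
Definition homotopic (R : realType) (X Y : topologicalType) (f g : X -> Y) :
    Prop :=
  exists H : X * R -> Y,
    [/\ {within [set: X] `*` `[0, 1], continuous H},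
        forall x, H (x, 0) = f x & forall x, H (x, 1) = g x].

Definition homotopy_equivalent (R : realType) (X Y : topologicalType) : Prop :=
  exists (f : X -> Y) (g : Y -> X),
    [/\ continuous f, continuous g,
        homotopic R (g \o f) idfun & homotopic R (f \o g) idfun].

End Homotopy.

Arguments geometric_realization R {T} D _.

(* Main.v *)
Require Import Defs.
From mathcomp Require Import all_boot all_order all_algebra.
From mathcomp Require Import all_classical all_reals all_analysis.
Import numFieldNormedType.Exports.

(** Both halves rest on one observation: the new vertex [v_F] lies in the single
    facet [F :|: {v_F}] of [Wh D].

    Full exposure.  For that reason [cl {v_F}] is the whole facet
    [F :|: {v_F}].  It contains an old vertex [i], since [F] is not empty, so
    [{v_F}] is a face that avoids [i] and has [i] in its closure; it exposes the
    facet ([Wh_fully_exposed]).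

    Homotopy type.  Sliding each [v_F] linearly to the barycenter of [F] carries
    the simplex on [F :|: {v_F}] into the simplex on [F], so it defines a map
    from [Wh D] to [D], and the inclusion of [D] goes the other way.  Neither
    composite has to be computed: it is enough that each keeps every point, with
    its image, inside one common simplex, because the straight-line homotopy then
    stays in the complex ([contiguous_homotopic]).

    Both maps have the same shape: each vertex goes to the barycenter of a
    nonempty set of vertices, and the map is extended linearly.  Such maps are
    governed by the set-valued function on vertices alone, and
    [carrier_homotopy_equivalent] turns the homotopy equivalence into finite set
    inclusions. *)

Set Implicit Arguments.
Unset Strict Implicit.
Unset Printing Implicit Defensive.
Import Order.TTheory GRing.Theory Num.Theory.

(** * Full exposure of the whiskering *)

Section Exposure.
Local Open Scope set_scope.
Variables (T : finType) (D : simplicial_complex T).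

Lemma facet_face F : F \in facets D -> F \in faces D.
Proof. by rewrite inE => /maxsetp. Qed.

Lemma face_sub_facet A : A \in faces D ->
  exists F : {F | F \in facets D}, A \subset val F.
Proof.
move=> /maxset_exists [F Fmax AF].
have FD : F \in facets D by rewrite inE.
by exists (exist _ F FD).
Qed.

(** The empty face is not maximal, as the singletons are faces. *)
Lemma facet_neq0 (i : T) F : F \in facets D -> F != finset.set0.
Proof.
rewrite inE => Fmax; apply/eqP => F0; move: Fmax; rewrite F0 => Fmax.
have := maxsetsup Fmax (faces_vertex D i) (finset.sub0set _).
by move/eqP; rewrite -finset.subset0 finset.sub1set inE.
Qed.

Lemma mem_inl_Wh_facet (i : T) (F : {F | F \in facets D}) :
  (inl i \in Wh_facet F) = (i \in val F).
Proof. by rewrite !inE mem_imset // => ? ? []. Qed.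

Lemma mem_inr_Wh_facet (G F : {F | F \in facets D}) :
  (inr G \in Wh_facet F) = (G == F).
Proof.
rewrite !inE; case: (G =P F) => [->|GF]; first by rewrite eqxx.
by apply/orP => -[/eqP[]//|/imsetP[]].
Qed.

Lemma Wh_facet_face F : Wh_facet F \in faces (Wh D).
Proof. by rewrite inE; apply/existsP; exists F. Qed.

(** Every face of [Wh D] lies in some [Wh_facet F], which is itself a face; so
    a maximal one must be equal to it. *)
Lemma facets_Wh G : G \in facets (Wh D) -> exists F, G = Wh_facet F.
Proof.
rewrite inE => Gmax; have := maxsetp Gmax; rewrite inE => /existsP[F GF].
by exists F; rewrite (maxsetsup Gmax (Wh_facet_face F) GF).
Qed.

(** The exposing face is the new vertex alone: only one facet contains it, so
    its closure picks up every old vertex of that facet. *)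
Lemma Wh_fully_exposed (i0 : T) : fully_exposed (Wh D).
Proof.
move=> G /facets_Wh [F ->{G}].
have /finset.set0Pn [i iF] := facet_neq0 i0 (valP F).
exists (inl i), [set inr F]; last by rewrite finset.sub1set mem_inr_Wh_facet.
rewrite inE faces_vertex finset.in_set1 /=.
apply/bigcapP => _ /andP[/facets_Wh [F' ->]].
by rewrite finset.sub1set mem_inr_Wh_facet mem_inl_Wh_facet => /eqP <-.
Qed.
End Exposure.

(** * Continuous maps into a geometric realization *)

Section Realization.
Local Open Scope classical_set_scope.
Local Open Scope ring_scope.
Variables (R : realType).

Definition support (T : finType) (x : T -> R) : {set T} :=
  [set i | x i != 0]%SET.

Section Coordinates.
Variables (T : finType) (D : simplicial_complex T).
Implicit Types x : geometric_realization R D.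

Lemma realization_ge0 x i : 0 <= val x i.
Proof. by have /set_mem [] := valP x. Qed.

Lemma realization_sum1 x : \sum_i val x i = 1.
Proof. by have /set_mem [] := valP x. Qed.

Lemma realization_support x : support (val x) \in faces D.
Proof. by have /set_mem [] := valP x. Qed.

Definition realization_point (y : T -> R) (Dy : geometric_realization R D y) :
    geometric_realization R D :=
  exist (fun z => z \in geometric_realization R D) y (mem_set Dy).

Lemma continuous_coordinate i :
  continuous (fun x : geometric_realization R D => val x i : R).
Proof.
move=> x; apply: (@continuous_comp _ _ _
  (val : geometric_realization R D -> prod_topology (fun=> R))
  (@proj T (fun=> R) i)).
  exact: initial_continuous.
exact: (@proj_continuous T (fun=> R) i).
Qed.

(** The realization has the initial topology for the inclusion in the product,
    and the product that of its projections, so coordinates suffice. *)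
Lemma continuous_into_realization (X : topologicalType)
    (f : X -> geometric_realization R D) :
  (forall i, continuous (fun z => val (f z) i : R)) -> continuous f.
Proof.
move=> fcont; apply: continuous_comp_initial => x.
apply/cvg_sup => i; move: x.
apply: (@continuous_comp_initial _ _ _ (fun g : T -> R => g i)).
exact: fcont.
Qed.
End Coordinates.

(** * Contiguous maps *)

Section Contiguity.
Variables (T : finType) (D : simplicial_complex T).

(** Clamping makes the straight-line homotopy a map on all of [R], as the
    notion of homotopy asks, while leaving [0, 1] unchanged. *)
Definition clamp (t : R) : R := Num.max 0 (Num.min t 1).

Lemma clamp_ge0 t : 0 <= clamp t.
Proof. by rewrite /clamp le_max lexx. Qed.

Lemma clamp_le1 t : clamp t <= 1.
Proof. by rewrite /clamp ge_max ler01 ge_min lexx orbT. Qed.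

Lemma continuous_clamp : continuous clamp.
Proof.
move=> t; apply: (@continuous_max R R (fun=> 0) (fun u => Num.min u 1)).
  exact: cvg_cst.
by apply: (@continuous_min R R id (fun=> 1)); [exact: cvg_id|exact: cvg_cst].
Qed.

Definition segment (x y : T -> R) (t : R) : T -> R :=
  fun i => (1 - clamp t) * x i + clamp t * y i.

Lemma support_segment x y t :
  support (segment x y t) \subset (support x :|: support y)%SET.
Proof.
apply/fintype.subsetP => i; rewrite !inE; apply: contraR.
by rewrite negb_or !negbK /segment => /andP[/eqP-> /eqP->]; rewrite !mulr0 addr0.
Qed.

Lemma segment_realization (x y : geometric_realization R D) t :
  (support (val x) :|: support (val y))%SET \in faces D ->
  geometric_realization R D (segment (val x) (val y) t).
Proof.
move=> xyD; split.
- move=> i; apply: addr_ge0; apply: mulr_ge0; rewrite ?realization_ge0 //.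
    by rewrite subr_ge0 clamp_le1.
  exact: clamp_ge0.
- by rewrite big_split /= -!mulr_sumr !realization_sum1 !mulr1 subrK.
- exact: faces_sub xyD (support_segment _ _ _).
Qed.

(** The straight line from [f x] to [g x] stays in the simplex spanned by both
    supports, so it never leaves the realization. *)
Lemma contiguous_homotopic (X : topologicalType)
    (f g : X -> geometric_realization R D) :
  continuous f -> continuous g ->
  (forall x, (support (val (f x)) :|: support (val (g x)))%SET \in faces D) ->
  homotopic R f g.
Proof.
move=> fc gc fg.
pose H (p : X * R) : geometric_realization R D :=
  realization_point (segment_realization p.2 (fg p.1)).
exists H; split.
- apply: continuous_subspaceT; apply: continuous_into_realization => i p /=.
  have clampc : {for p, continuous (fun q : X * R => clamp q.2)}.
    by apply: continuous_comp; [exact: cvg_snd|exact: continuous_clamp].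
  have coordc (h : X -> geometric_realization R D) : continuous h ->
      {for p, continuous (fun q : X * R => val (h q.1) i : R)}.
    move=> hc; apply: (@continuous_comp _ _ _ (fun q : X * R => h q.1)
      (fun z => val z i : R)).
      by apply: continuous_comp; [exact: cvg_fst|exact: hc].
    exact: continuous_coordinate.
  apply: cvgD; apply: cvgM; [|exact: coordc|exact: clampc|exact: coordc].
  by apply: cvgB; [exact: cvg_cst|exact: clampc].
- move=> x; apply: val_inj; apply/funext => i /=.
  by rewrite /segment /clamp min_l ?ler01 // maxxx subr0 mul1r mul0r addr0.
- move=> x; apply: val_inj; apply/funext => i /=.
  by rewrite /segment /clamp minxx max_r ?ler01 // subrr mul1r mul0r add0r.
Qed.
End Contiguity.

(** * Linear extension of barycenters *)

Section Carrier.
Variables (T V : finType) (c : T -> {set V}).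

Definition carrier (A : {set T}) : {set V} := (\bigcup_(i in A) c i)%SET.

Definition barycenter (B : {set V}) (v : V) : R := (v \in B)%:R / #|B|%:R.

Definition bary_ext (x : T -> R) : V -> R :=
  fun v => \sum_i x i * barycenter (c i) v.

Lemma barycenter_ge0 B v : 0 <= barycenter B v.
Proof. by rewrite divr_ge0. Qed.

Lemma barycenter_sum1 B : B != finset.set0 -> \sum_v barycenter B v = 1.
Proof.
move=> B0; rewrite -mulr_suml -natr_sum -big_mkcond /= sum1_card divff //.
by rewrite pnatr_eq0 cards_eq0.
Qed.

(** This bound lets faces be tracked by finite sets instead of coordinates. *)
Lemma support_bary_ext x : support (bary_ext x) \subset carrier (support x).
Proof.
apply/fintype.subsetP => v; rewrite !inE; apply: contraR => vNc.
rewrite /bary_ext big1 // => i _; have [->|xi0] := eqVneq (x i) 0.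
  by rewrite mul0r.
have /negPf vNci : v \notin c i.
  by apply: contra vNc => vci; apply/finset.bigcupP; exists i; rewrite ?inE.
by rewrite /barycenter vNci mul0r mulr0.
Qed.

Variables (D : simplicial_complex T) (E : simplicial_complex V).
Hypothesis c_neq0 : forall i, c i != finset.set0.
Hypothesis cDE : forall A, A \in faces D -> carrier A \in faces E.

Lemma bary_ext_realization (x : geometric_realization R D) :
  geometric_realization R E (bary_ext (val x)).
Proof.
split.
- move=> v; apply: sumr_ge0 => i _.
  by rewrite mulr_ge0 ?realization_ge0 ?barycenter_ge0.
- rewrite exchange_big /= -(realization_sum1 x); apply: eq_bigr => i _.
  by rewrite -mulr_sumr barycenter_sum1 ?mulr1.
- exact: faces_sub (cDE (realization_support x)) (support_bary_ext _).
Qed.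

Definition bary_map (x : geometric_realization R D) :
    geometric_realization R E :=
  realization_point (bary_ext_realization x).

Lemma continuous_bary_map : continuous bary_map.
Proof.
apply: continuous_into_realization => v /=; rewrite /bary_ext.
apply: continuous_big; first exact: add_continuous.
move=> i _ x; apply: cvgM (@continuous_coordinate _ D i x) (cvg_cst _).
Qed.
End Carrier.

Lemma carrierS (T V : finType) (c : T -> {set V}) (A B : {set T}) :
  A \subset B -> carrier c A \subset carrier c B.
Proof.
move=> /fintype.subsetP AB; apply/bigcupsP => i /AB iB; exact: finset.bigcup_sup.
Qed.

(** The last two conditions put each point of the realization and its image
    under the round trip in a common face, which is the contiguity of the
    round trip with the identity. *)
Lemma carrier_homotopy_equivalent (T V : finType)
    (D : simplicial_complex T) (E : simplicial_complex V)
    (c : T -> {set V}) (d : V -> {set T}) :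
  (forall i, c i != finset.set0) -> (forall v, d v != finset.set0) ->
  (forall A, A \in faces D -> carrier c A \in faces E) ->
  (forall B, B \in faces E -> carrier d B \in faces D) ->
  (forall A, A \in faces D -> (carrier d (carrier c A) :|: A)%SET \in faces D) ->
  (forall B, B \in faces E -> (carrier c (carrier d B) :|: B)%SET \in faces E) ->
  homotopy_equivalent R (geometric_realization R D) (geometric_realization R E).
Proof.
move=> c0 d0 cDE dED dc cd.
have cc := @continuous_bary_map _ _ _ _ _ c0 cDE.
have dcont := @continuous_bary_map _ _ _ _ _ d0 dED.
exists (bary_map c0 cDE), (bary_map d0 dED); split => //.
- apply: contiguous_homotopic => [x|x|x]; [|exact: cvg_id|].
    by apply: continuous_comp; [exact: cc|exact: dcont].
  apply: faces_sub (dc _ (realization_support x)) _; apply: finset.setSU.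
  apply: (fintype.subset_trans (support_bary_ext _ _)).
  exact: carrierS (support_bary_ext _ _).
- apply: contiguous_homotopic => [x|x|x]; [|exact: cvg_id|].
    by apply: continuous_comp; [exact: dcont|exact: cc].
  apply: faces_sub (cd _ (realization_support x)) _; apply: finset.setSU.
  apply: (fintype.subset_trans (support_bary_ext _ _)).
  exact: carrierS (support_bary_ext _ _).
Qed.

Lemma homotopy_equivalent_sym (X Y : topologicalType) :
  homotopy_equivalent R X Y -> homotopy_equivalent R Y X.
Proof. by move=> [f [g [fc gc gf fg]]]; exists g, f. Qed.
End Realization.

(** * Collapsing the whiskers *)

Section Collapse.
Variables (T : finType) (D : simplicial_complex T).

Definition Wh_collapse (v : Wh_vertex D) : {set T} :=
  match v with inl i => [set i]%SET | inr F => val F end.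

Definition Wh_incl (i : T) : {set Wh_vertex D} := [set inl i]%SET.

Lemma carrier_collapse_facet (A : {set Wh_vertex D}) (F : {F | F \in facets D}) :
  A \subset Wh_facet F -> carrier Wh_collapse A \subset val F.
Proof.
move=> /fintype.subsetP AF; apply/bigcupsP => -[i|G] /AF.
  by rewrite mem_inl_Wh_facet finset.sub1set.
by rewrite mem_inr_Wh_facet => /eqP ->.
Qed.

Lemma carrier_incl_facet (A : {set T}) (F : {F | F \in facets D}) :
  A \subset val F -> carrier Wh_incl A \subset Wh_facet F.
Proof.
move=> /fintype.subsetP AF; apply/bigcupsP => i /AF iF.
by rewrite finset.sub1set mem_inl_Wh_facet.
Qed.

(** Collapse and inclusion exchange the subsets of [Wh_facet F] with those of
    [F], for the same [F].  A round trip from a face thus ends in the facet it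
    started from, which therefore contains both the face and its image. *)
Lemma Wh_homotopy_equivalent (R : realType) (i0 : T) :
  homotopy_equivalent R (geometric_realization R (Wh D))
                        (geometric_realization R D).
Proof.
have val_face (F : {F | F \in facets D}) := facet_face (valP F).
apply: (@carrier_homotopy_equivalent R _ _ _ _ Wh_collapse Wh_incl).
- case=> [i|F]; last exact: (facet_neq0 i0 (valP F)).
  by apply/finset.set0Pn; exists i; rewrite inE.
- by move=> i; apply/finset.set0Pn; exists (inl i); rewrite inE.
- move=> A; rewrite inE => /existsP[F AF].
  exact: faces_sub (val_face F) (carrier_collapse_facet AF).
- move=> B /face_sub_facet [F BF].
  exact: faces_sub (Wh_facet_face F) (carrier_incl_facet BF).
- move=> A; rewrite inE => /existsP[F AF].
  apply: faces_sub (Wh_facet_face F) _; rewrite finset.subUset AF andbT.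
  exact/carrier_incl_facet/carrier_collapse_facet.
- move=> B /face_sub_facet [F BF].
  apply: faces_sub (val_face F) _; rewrite finset.subUset BF andbT.
  exact/carrier_collapse_facet/carrier_incl_facet.
Qed.
End Collapse.

Theorem proposition2p20 (R : realType) (n : nat) (hn : (0 < n)%N)
    (D : simplicial_complex 'I_n) :
  (exists (V : finType) (G : simplicial_complex V),
      fully_exposed G /\
      homotopy_equivalent R (geometric_realization R D)
                            (geometric_realization R G)) /\
  (fully_exposed (Wh D) /\
   homotopy_equivalent R (geometric_realization R (Wh D))
                         (geometric_realization R D)).
Proof.
have i0 : 'I_n := Ordinal hn.
have WhE : fully_exposed (Wh D) by exact: Wh_fully_exposed i0.
have WhD := Wh_homotopy_equivalent D R i0.
split=> //; exists (Wh_vertex D), (Wh D); split=> //.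
exact: homotopy_equivalent_sym.
Qed.
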